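(* Let $\mathcal{H}$ be a real Hilbert space, let $\mathcal{Y} \subset \mathcal{H}$ be open and convex, and let $f: \mathcal{Y} \to \mathcal{H}$ be $C^1$ with $Df(y)$ symmetric positive definite for every $y\in\mathcal{Y}$. Then $f$ is injective and there is $\varphi: \mathcal{H} \to \mathbb{R} \cup \{+\infty\}$ such that $\mathrm{prox}_\varphi(y) = \{f(y)\}$ for all $y \in \mathcal{Y}$ and $\mathrm{dom}(\varphi) = \mathrm{Im}(f)$. Moreover, if $Df(y)$ is boundedly invertible for every $y\in\mathcal{Y}$, then $\varphi$ is $C^{1}$ on $\mathrm{Im}(f)$ and for each $y \in \mathcal{Y}$, the only critical point of $x \mapsto \tfrac{1}{2}\|y-x\|^2+\varphi(x)$ is $x=f(y)$.
   Context: For $\varphi: \mathcal{H} \to \mathbb{R}\cup\{+\infty\}$, $\mathrm{dom}(\varphi)=\{x:\varphi(x)<+\infty\}$ and $\mathrm{prox}_\varphi(y) := \arg\min_{x \in \mathcal{H}} \{\tfrac12\|y-x\|^2 + \varphi(x)\}$ is the set of global minimizers (with finite objective value). $\mathrm{Im}(f)=f(\mathcal{Y})$. Differentiability is in the Fréchet sense; $Df(y)$ is the differential of $f$ at $y$. A continuous linear operator $L:\mathcal{H}\to\mathcal{H}$ is symmetric if $\langle x,Ly\rangle=\langle Lx,y\rangle$ for all $x,y$; a symmetric $L$ is positive definite if $\langle x,Lx\rangle>0$ for each nonzero $x\in\mathcal{H}$; $L$ is boundedly invertible if it is bijective with bounded inverse. A critical point of $x\mapsto\tfrac12\|y-x\|^2+\varphi(x)$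 is a point of $\mathrm{dom}(\varphi)$ at which this function is differentiable with zero gradient. *)

(* Defs.v *)
From HB Require Import structures.
From mathcomp Require Import all_boot all_order all_algebra sesquilinear.
From mathcomp Require Import all_classical all_reals all_analysis.
Set Implicit Arguments.
Unset Strict Implicit.
Unset Printing Implicit Defensive.
Import Order.TTheory GRing.Theory Num.Theory.
Import numFieldNormedType.Exports.

Local Open Scope classical_set_scope.
Local Open Scope ring_scope.

(* A real Hilbert space is a complete normed module together with a real inner
   product (a symmetric positive definite bilinear form) inducing its norm. *)
Definition norm_induced_by (R : realType) (H : normedModType R)
    (dot : {dot H for idfun}) : Prop :=
  forall x : H, `|x| ^+ 2 = dot x x.

Section Calculus.
Context {R : realType} {V W : normedModType R}.

(* [differentiable f x] and ['d f x] refer to neighbourhoods of x in V. So a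
   function defined on an open [A] only is rendered by any total extension [f],
   and the values of [f] outside [A] are irrelevant. The second clause is the
   continuity on [A] of z |-> 'd f z for the operator norm. *)
Definition C1_on (A : set V) (f : V -> W) : Prop :=
  (forall x, A x -> differentiable f x) /\
  (forall x, A x -> forall e : R, 0 < e ->
     \forall z \near within A (nbhs x),
       forall h : V, `|'d f z h - 'd f x h| <= e * `|h|).

End Calculus.

Section Operators.
Context {R : realType} {H : normedModType R}.

Definition symmetric_op (dot : {dot H for idfun}) (L : H -> H) : Prop :=
  forall x y : H, dot x (L y) = dot (L x) y.

Definition positive_definite_op (dot : {dot H for idfun}) (L : H -> H) : Prop :=
  forall x : H, x != 0 -> 0 < dot x (L x).

Definition boundedly_invertible (L : H -> H) : Prop :=
  exists M : H -> H, [/\ cancel L M, cancel M L &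
    exists C : R, forall x : H, `|M x| <= C * `|x|].

End Operators.

(* Functions H -> R U {+oo} are functions H -> \bar R that never take the value
   -oo; this is required separately. *)
Section Extended.
Context {R : realType} {H : normedModType R}.
Implicit Types (phi g : H -> \bar R).

Definition edom phi : set H := [set x | (phi x < +oo)%E].

Definition prox_objective phi (y x : H) : \bar R :=
  ((2^-1 * `|y - x| ^+ 2)%:E + phi x)%E.

(* The first clause excludes "minimizers" of an identically infinite objective. *)
Definition prox phi (y : H) : set H :=
  [set x | (prox_objective phi y x < +oo)%E /\
           forall z : H, (prox_objective phi y x <= prox_objective phi y z)%E].

(* [fine] replaces infinite values by 0: differentiability of [fine \o g] at x
   means differentiability of g at x only when g is finite around x. *)
Definition finite_near g (x : H) : Prop := \forall z \near x, g z \is a fin_num.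

Definition eC1_on (A : set H) g : Prop :=
  (forall x, A x -> finite_near g x) /\ C1_on A (fine \o g : H -> R^o).

Definition has_gradient (dot : {dot H for idfun}) g (x v : H) : Prop :=
  [/\ finite_near g x, differentiable (fine \o g : H -> R^o) x &
      forall h : H, 'd (fine \o g : H -> R^o) x h = dot v h].

Definition critical_points (dot : {dot H for idfun}) phi (y : H) : set H :=
  [set x | edom phi x /\ has_gradient dot (prox_objective phi y) x 0].

End Extended.

(* Main.v *)
Require Import Defs.
From HB Require Import structures.
From mathcomp Require Import all_boot all_order all_algebra sesquilinear.
From mathcomp Require Import all_classical all_reals all_analysis.
From mathcomp Require Import ring lra.
Set Implicit Arguments.
Unset Strict Implicit.
Unset Printing Implicit Defensive.
Import Order.TTheory GRing.Theory Num.Theory.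
Import numFieldNormedType.Exports.

Local Open Scope classical_set_scope.
Local Open Scope ring_scope.

(* Since Df is symmetric and Y is convex, f has a potential psi on Y, namely the
   work of f along segments issued from a fixed point (Poincare lemma). As Df is
   positive definite, psi is strictly convex along segments, so that
   psi y > psi z + <f z, y - z> whenever y <> z; in particular f is injective.
   Set phi (f z) = <z, f z> - |f z|^2 / 2 - psi z and phi = +oo outside Im f. Then
     |y - f z|^2 / 2 + phi (f z) = |y|^2 / 2 - (psi z + <f z, y - z>),
   which is minimal exactly at z = y. When the differentials are boundedly
   invertible, f is an open map (contraction principle), hence its inverse is
   continuous, and the subgradient inequalities alone show that phi has gradient
   z - f z at f z; the objective then has gradient z - y there. *)

(** * Inner product algebra and the Cauchy-Schwarz inequality *)

Section InnerProduct.
Context {R : realType} {H : completeNormedModType R} (dot : {dot H for idfun}).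
Implicit Types (x y z : H) (a : R).

Lemma dotC x y : dot x y = dot y x.
Proof. by have := @hermitian_subproof _ _ _ _ dot x y; rewrite expr0 mul1r. Qed.

Lemma dotDr x y z : dot x (y + z) = dot x y + dot x z.
Proof. exact: linearDr. Qed.

Lemma dotNr x y : dot x (- y) = - dot x y.
Proof. exact: linearNr. Qed.

Lemma dotZr x a y : dot x (a *: y) = a * dot x y.
Proof. exact: linearZr_LR. Qed.

Lemma dotDl x y z : dot (x + y) z = dot x z + dot y z.
Proof. by rewrite !(dotC _ z) dotDr. Qed.

Lemma dotNl x y : dot (- x) y = - dot x y.
Proof. by rewrite !(dotC _ y) dotNr. Qed.

Lemma dotZl a x y : dot (a *: x) y = a * dot x y.
Proof. by rewrite !(dotC _ y) dotZr. Qed.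

Definition dotE := (dotDl, dotDr, dotNl, dotNr, dotZl, dotZr).

Lemma dot0l x : dot 0 x = 0.
Proof. by rewrite -(scale0r x) dotZl mul0r. Qed.

Hypothesis dot_norm : norm_induced_by dot.

Lemma cauchy_schwarz x y : dot x y <= `|x| * `|y|.
Proof.
have [->|x0] := eqVneq x 0; first by rewrite dot0l normr0 mul0r.
have [->|y0] := eqVneq y 0; first by rewrite dotC dot0l normr0 mulr0.
have xy0 : 0 < `|x| * `|y| by rewrite mulr_gt0 ?normr_gt0.
(* The expansion of this square is 2|x||y|(|x||y| - <x, y>). *)
have := sqr_ge0 `| `|y| *: x - `|x| *: y |.
rewrite dot_norm !dotE -!dot_norm (dotC y x) => h.
rewrite -(ler_pM2l xy0).
by nra.
Qed.

Lemma abs_dot_le x y : `|dot x y| <= `|x| * `|y|.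
Proof.
by rewrite ler_norml cauchy_schwarz lerNl -dotNl -(normrN x) cauchy_schwarz.
Qed.

End InnerProduct.

(** * Differentials from first-order estimates, and derivatives along lines *)

Section NearDifferential.
Context {R : realType} {V W : normedModType R}.

Lemma near_diff (f : V -> W) (x : V) (l : {linear V -> W}) : continuous l ->
  (forall e : R, 0 < e ->
     \forall h \near 0, `|f (x + h) - f x - l h| <= e * `|h|) ->
  differentiable f x /\ 'd f x = l :> (V -> W).
Proof.
move=> lc fl.
have fE : f \o shift x = cst (f x) + l +o_ 0 id.
  apply/eqaddoP => e e0; have := fl e e0; apply: filterS => h /=.
  by rewrite !fctE opprD addrA /= [h + x]addrC.
have dE := diff_unique lc fE; split=> //.
by apply/diff_locallyP; rewrite dE.
Qed.

End NearDifferential.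

Section LinearFunctional.
Context {R : realType} {H : completeNormedModType R} (dot : {dot H for idfun}).

Definition dot_right (u : H) : H -> R^o := dot u.

Let dot_right_linear u : linear (dot_right u).
Proof. by move=> a x y; rewrite /dot_right dotDr dotZr. Qed.

HB.instance Definition _ u := GRing.isLinear.Build R H R^o *:%R
  (dot_right u) (dot_right_linear u).

Hypothesis dot_norm : norm_induced_by dot.

Lemma dot_right_continuous u : continuous (dot_right u).
Proof.
apply: (@bounded_linear_continuous R H R^o (dot_right u)); apply/linear_boundedP.
exists `|u|; split; first exact: num_real.
by move=> r ur x; rewrite (le_trans (abs_dot_le dot_norm _ _))// ler_wpM2r// ltW.
Qed.

End LinearFunctional.

Section Line.
Context {R : realType} {V W : normedModType R}.

Lemma line_continuous (a v : V) : continuous (fun s : R => a + s *: v).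
Proof.
by move=> t; apply: cvgD; [exact: cvg_cst|apply: cvgZl; exact: cvg_id].
Qed.

Lemma is_derive_line (F : V -> W) (a v : V) (t : R) :
  differentiable F (a + t *: v) ->
  is_derive t 1 (fun s : R => F (a + s *: v)) ('d F (a + t *: v) v).
Proof.
move=> dF.
have dl : is_diff t (fun s : R => a + s *: v) (0 + *:%R^~ v).
  exact: is_diffD.
have /= dc := @diff_comp R R V W (fun s : R => a + s *: v) F t (@ex_diff _ _ _ _ _ _ _ dl) dF.
have dcd : differentiable (F \o (fun s : R => a + s *: v)) t.
  by apply: differentiable_comp => //; exact: ex_diff.
apply: DeriveDef; first by apply: diff_derivable; exact: dcd.
rewrite [LHS](deriveE _ dcd) dc /= diff_val /=.
by rewrite !fctE add0r scale1r.
Qed.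

End Line.

(** * Mean value estimates and uniform differentiability of C1 maps *)

Section MeanValue.
Context {R : realType} {H : completeNormedModType R} (dot : {dot H for idfun}).
Hypothesis dot_norm : norm_induced_by dot.

Lemma is_derive_dot_line (f : H -> H) (a v u : H) (t : R) :
  differentiable f (a + t *: v) ->
  is_derive t (1 : R) (fun s : R => dot (f (a + s *: v)) u : R^o)
    (dot ('d f (a + t *: v) v) u).
Proof.
move=> df.
have dd x := linear_differentiable x (@dot_right_continuous R H dot dot_norm u).
have dg := differentiable_comp df (dd _).
have := is_derive_line dg.
rewrite diff_comp// diff_lin /=; last exact: dot_right_continuous.
rewrite /= {2}/dot_right dotC.
by under eq_fun do rewrite /dot_right dotC.
Qed.

Lemma MVT01 (g dg : R -> R) :
  (forall t : R, 0 <= t <= 1 -> is_derive t (1 : R) g (dg t)) ->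
  exists2 c, 0 < c < 1 & g 1 - g 0 = dg c.
Proof.
move=> gd.
have [|||c c01 ->] := @MVT R g dg 0 1; first exact: ltr01.
- by move=> t; rewrite in_itv/= => /andP[t0 t1]; apply: gd; rewrite !ltW.
- apply: derivable_within_continuous => t; rewrite in_itv/= => t01.
  exact: (@ex_derive _ _ _ _ _ _ _ (gd t t01)).
- by exists c; [move: c01; rewrite in_itv/=|rewrite subr0 mulr1].
Qed.

(** The scalar mean value theorem is applied to f along the segment, minus its expected linear
    growth, paired with the error [e] itself; it gives |e|^2 = <Df v - w, e> <= C |e|. *)
Lemma mean_value_ineq (f : H -> H) (a v w : H) (C : R) :
  (forall t : R, 0 <= t <= 1 -> differentiable f (a + t *: v)) ->
  (forall t : R, 0 <= t <= 1 -> `|'d f (a + t *: v) v - w| <= C) ->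
  `|f (a + v) - f a - w| <= C.
Proof.
move=> df dfC; set e := f (a + v) - f a - w.
pose g t := dot (f (a + t *: v)) e - t * dot w e.
have gd (t : R) : 0 <= t <= 1 -> is_derive t (1 : R) g (dot ('d f (a + t *: v) v - w) e).
  move=> t01; have h := is_derive_dot_line e (df t t01).
  rewrite dotDl dotNl; apply: is_deriveB.
  by apply: is_derive_eq; rewrite scaler0 add0r /GRing.scale /= mulr1.
have [c /andP[c0 c1]] := MVT01 gd.
rewrite /g scale1r scale0r addr0 mul1r mul0r subr0 => E.
have {}E : `|e| ^+ 2 = dot ('d f (a + c *: v) v - w) e.
  by rewrite -E dot_norm {1}/e !dotE; ring.
have [->|e0] := eqVneq e 0; last first.
  have e1 : 0 < `|e| by rewrite normr_gt0.
  rewrite -(ler_pM2r e1) -expr2 E.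
  rewrite (le_trans (cauchy_schwarz dot_norm _ _))//.
  by rewrite ler_wpM2r// dfC// !ltW.
by rewrite normr0 (le_trans _ (dfC 0 _))// lexx ler01.
Qed.

(** Continuity of Df keeps Df(z + t h) close to Df(x) along short segments near [x], so
    [mean_value_ineq] bounds the error with the differential frozen at [x]. *)
Lemma strict_diff (Y : set H) (f : H -> H) (x : H) : open Y -> C1_on Y f -> Y x ->
  forall e : R, 0 < e -> \forall z \near x & h \near 0,
    `|f (z + h) - f z - 'd f x h| <= e * `|h|.
Proof.
move=> oY [df cdf] Yx e e0.
have /nbhs_ballP[r /= r0 xr] : nbhs x Y by exact: open_nbhs_nbhs.
have := cdf x Yx e e0.
rewrite /within /= => /nbhs_ballP[s /= s0 xs].
(* Half the radius for [z] and half for [h] keep the whole segment in both balls. *)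
pose d := Num.min r s / 2.
have d0 : 0 < d by rewrite divr_gt0// lt_min r0 s0.
exists (ball x d, ball 0 d); first by split; exact: nbhsx_ballx.
move=> [z h] /= [xz]; rewrite -ball_normE /ball_ /= sub0r normrN => hd.
have xzt t : 0 <= t <= 1 -> ball x (Num.min r s) (z + t *: h).
  move=> /andP[t0 t1]; move: xz; rewrite -!ball_normE /ball_ /= => xz.
  rewrite opprD addrA (le_lt_trans (ler_normB _ _))//.
  rewrite [ltRHS](splitr (Num.min r s)) ltrD//.
  rewrite normrZ (le_lt_trans _ hd)// ger0_norm//.
  by rewrite ler_piMl.
have Yt t : 0 <= t <= 1 -> Y (z + t *: h).
  move=> t01; apply: xr; apply: le_ball (xzt t t01).
  by rewrite ge_min lexx.
apply: mean_value_ineq => t t01; first exact/df/Yt.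
apply: xs (Yt t t01) _; apply: le_ball (xzt t t01).
by rewrite ge_min lexx orbT.
Qed.

(** Half of [e] comes from strict differentiability at [x], half from replacing ['d f x] by
    ['d f z]. *)
Lemma locally_uniform_diff (Y : set H) (f : H -> H) (x : H) :
  open Y -> C1_on Y f -> Y x ->
  forall e : R, 0 < e -> \forall z \near x & h \near 0,
    `|f (z + h) - f z - 'd f z h| <= e * `|h|.
Proof.
move=> oY fC1 Yx e e0; have e20 : 0 < e / 2 by rewrite divr_gt0.
have := strict_diff oY fC1 Yx e20.
have YN : \forall z \near x & h \near (0 : H), Y z.
  by exists (Y, setT); [split; [exact: open_nbhs_nbhs|exact: filterT]|case=> ? ? []].
have dN : \forall z \near x & h \near (0 : H),
    Y z -> forall k : H, `|'d f z k - 'd f x k| <= e / 2 * `|k|.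
  exists ([set z | Y z -> forall k : H, `|'d f z k - 'd f x k| <= e / 2 * `|k|], setT).
    by split; [exact: (fC1.2 x Yx _ e20)|exact: filterT].
  by case=> ? ? [].
apply: filterS3 YN dN => -[z h] /= Yz /(_ Yz h) dz sd.
rewrite [f _ - _ - _](_ : _ = (f (z + h) - f z - 'd f x h) - ('d f z h - 'd f x h)).
  by rewrite (le_trans (ler_normB _ _))// [e]splitr mulrDl lerD.
by rewrite opprB addrA subrK.
Qed.

End MeanValue.

(** * Uniformity along segments, by compactness *)

Section LocalUniformity.
Context {R : realType} {V : normedModType R}.

(** Compactness of [[0, 1]] merges the neighbourhoods found at each point of the segment into a
    single one for [h]. *)
Lemma near_segment (P : V -> V -> Prop) (a u : V) :
  (forall t : R, 0 <= t <= 1 -> \forall z \near a + t *: u & h \near 0, P z h) ->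
  \forall h \near 0, forall t : R, 0 <= t <= 1 -> P (a + t *: u) h.
Proof.
move=> aP.
have /compact_near_coveringP/near_covering_withinP := @segment_compact R 0 1.
move=> /(_ _ (nbhs (0 : V)) (fun h t => P (a + t *: u) h)) cov.
have : \forall h \near nbhs (0 : V), `[0, 1]%classic `<=` (fun t : R => P (a + t *: u) h).
  apply: cov => t; rewrite /= in_itv/= => /aP[[A B] /= [tA B0] AB].
  exists ([set s : R | A (a + s *: u)], B) => /=.
    by split => //; exact: line_continuous tA.
  by move=> [s h] /= [As Bh] _; exact: (AB (_, _)).
by apply: filterS => h hP t t01; apply: hP; rewrite /= in_itv.
Qed.

(** Serves for segments with a common origin: when the endpoint moves by [h], the point at parameter
    [t] moves by [t *: h]. *)
Lemma near0_scale (P : V -> Prop) : (\forall h \near 0, P h) ->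
  \forall h \near 0, forall t : R, 0 <= t <= 1 -> P (t *: h).
Proof.
move=> /nbhs_ballP[r /= r0 rP]; apply/nbhs_ballP; exists r => //= h.
rewrite -ball_normE /ball_ /= sub0r normrN => hr t /andP[t0 t1].
apply: rP; rewrite -ball_normE /ball_ /= sub0r normrN normrZ ger0_norm//.
by rewrite (le_lt_trans _ hr)// ler_piMl.
Qed.

Lemma near_continuous_increment (W : normedModType R) (f : V -> W) (x : V) :
  {for x, continuous f} ->
  forall e : R, 0 < e ->
  \forall z \near x & h \near 0, `|f (z + h) - f z| <= e.
Proof.
move=> /cvgrPdist_lt fx e e0; have e20 : 0 < e / 2 by rewrite divr_gt0.
have /nbhs_ballP[r /= r0 xr] := fx _ e20.
have r20 : 0 < r / 2 by rewrite divr_gt0.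
exists (ball x (r / 2), ball 0 (r / 2)); first by split; exact: nbhsx_ballx.
move=> [z h] /= [xz hr].
have xzr : ball x r z by apply: le_ball xz; lra.
have xzh : ball x r (z + h).
  move: xz hr; rewrite -!ball_normE /ball_ /= sub0r normrN => xz hr.
  by rewrite opprD addrA (le_lt_trans (ler_normB _ _))// [r]splitr ltrD.
rewrite -(subrKA (f x)) [leRHS]splitr (le_trans (ler_normD _ _))// lerD//.
  by rewrite distrC ltW// xr.
by rewrite ltW// xr.
Qed.

End LocalUniformity.

(** * Primitives of continuous functions, and segments of convex sets *)

Lemma primitive01 {R : realType} (F : R -> R) :
  (forall t : R, 0 <= t <= 1 -> {for t, continuous F}) ->
  exists P : R -> R, forall t : R, 0 <= t <= 1 -> is_derive t (1 : R) P (F t).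
Proof.
move=> cF.
(* Clamping extends F continuously to R, as the fundamental theorem requires
   two-sided continuity at the endpoints. *)
pose clamp (t : R) := Num.min (Num.max t 0) 1.
have clamp01 t : 0 <= clamp t <= 1.
  by rewrite /clamp le_min ler01 ge_min le_max !lexx !orbT.
have clampE t : 0 <= t <= 1 -> clamp t = t.
  by move=> /andP[t0 t1]; rewrite /clamp max_l// min_l.
have cclamp : continuous clamp.
  move=> t; apply: (@continuous_min R R (id \max cst 0) (cst 1)).
    by apply: (@continuous_max R R id (cst 0)) => //; exact: cst_continuous.
  exact: cst_continuous.
have cG : continuous (F \o clamp).
  by move=> t; apply: continuous_comp; [exact: cclamp|exact: cF].
(* Integrating over [[-1, 2]] makes 0 and 1 interior points. *)
have iG : (lebesgue_measure : measure (measurableTypeR R) R).-integrable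
    `[(-1 : R), 2] (EFin \o (F \o clamp)).
  apply: continuous_compact_integrable; first exact: segment_compact.
  exact: continuous_subspaceT.
exists (fun x => \int[lebesgue_measure]_(t in `[-1, x]) (F \o clamp) t)%R.
move=> t t01; have /andP[t0 t1] := t01.
have t2 : t < 2 by lra.
have m1t : -1 < t by lra.
have [dP PE] := continuous_FTC1_closed t2 iG m1t (cG t).
apply: DeriveDef => //.
by rewrite -derive1E PE /= clampE.
Qed.

Lemma convex_set_segment {R : realType} {H : lmodType R} (Y : set H) :
  convex_set (Y : set (convex_lmodType H)) ->
  forall a u (t : R), Y a -> Y (a + u) -> 0 <= t <= 1 -> Y (a + t *: u).
Proof.
move=> cY a u t Ya Yu /andP[t0 t1].
have /set_mem := cY (a + u) a (Itv01 t0 t1) (mem_set Yu) (mem_set Ya).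
rewrite /conv /= /unstable.onem scalerDr addrAC -scalerDl addrCA subrr addr0 scale1r.
by [].
Qed.

(** * The potential of f and its strict convexity *)

Section Potential.
Context {R : realType} {H : completeNormedModType R} (dot : {dot H for idfun}).
Hypothesis dot_norm : norm_induced_by dot.
Variables (Y : set H) (f : H -> H).
Hypotheses (Y_open : open Y) (f_C1 : C1_on Y f).
Hypothesis (Y_convex : convex_set (Y : set (convex_lmodType H))).
Hypothesis f_sym : forall y, Y y -> symmetric_op dot ('d f y).

(* With p = Df(x)(t h) and q = Df(x) u, the hypothesis is the symmetry of Df(x)
   and the left-hand side is the t-derivative of the first-order error of the
   potential. Its right-hand side involves only increments of f, so it is o(h). *)
Lemma work_increment (a b p q u h : H) (t : R) : dot p u = t * dot q h ->
  dot a (u + h) - dot b u - (t *: dot q h + (dot b h)%:A) =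
    dot (a - b - p) u + dot (a - b) h.
Proof.
move=> pu; rewrite [(dot b h)%:A]mulr1 -[t *: _]pu !(dotE dot).
move: (dot a u) (dot a h) (dot b u) (dot b h) (dot p u) => *; ring.
Qed.

Lemma potential : exists psi : H -> R, forall w, Y w ->
  forall e : R, 0 < e ->
  \forall h \near 0, `|psi (w + h) - psi w - dot (f w) h| <= e * `|h|.
Proof.
have [[y0 Yy0]|Y0] := pselect (exists y, Y y); last first.
  by exists (fun=> 0) => w Yw; exfalso; apply: Y0; exists w.
pose F w (t : R) := dot (f (y0 + t *: (w - y0))) (w - y0).
have Yseg w (t : R) : Y w -> 0 <= t <= 1 -> Y (y0 + t *: (w - y0)).
  by move=> Yw; apply: convex_set_segment => //; rewrite addrC subrK.
have [df _] := f_C1.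
have primF w : exists P : R -> R, Y w ->
    forall t : R, 0 <= t <= 1 -> is_derive t (1 : R) P (F w t).
  have [Yw|nYw] := pselect (Y w); last by exists (fun=> 0).
  have [|P PF] := @primitive01 R (F w); last by exists P.
  move=> t t01; apply: differentiable_continuous; apply/derivable1_diffP.
  exact: (@ex_derive _ _ _ _ _ _ _ (is_derive_dot_line dot_norm (w - y0) (df _ (Yseg w t Yw t01)))).
have [P PF] := choice primF.
(* P w 1 - P w 0 is the work of f along the segment from y0 to w. *)
exists (fun w => P w 1 - P w 0) => w Yw e e0.
(* The two terms of [dQ] below are at most e1 |h| |u| and e1 |h|, which add up to e |h|. *)
pose u := w - y0; pose e1 := e / (`|u| + 1).
have u1 : 0 < `|u| + 1 by rewrite ltr_wpDl.
have e10 : 0 < e1 by rewrite divr_gt0.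
have := near0_scale (near_segment (fun t t01 =>
  locally_uniform_diff dot_norm Y_open f_C1 (Yseg w t Yw t01) e10)).
have := near0_scale (near_segment (fun t t01 =>
  near_continuous_increment (differentiable_continuous (df _ (Yseg w t Yw t01))) e10)).
have Yh : \forall h \near 0, Y (w + h).
  have : nbhs (w + 0) Y by rewrite addr0; exact: open_nbhs_nbhs.
  exact: (cvgD (@cvg_cst _ _ _ _ _) cvg_id).
apply: filterS3 Yh => h Ywh incr lin.
pose gam (t : R) := y0 + t *: u.
(* By construction [Q 1 - Q 0] is the first-order error of the potential at [w], so the mean value
   theorem reduces the claim to a bound on [dQ]. *)
pose Q t := P (w + h) t - P w t - t * dot (f (gam t)) h.
pose dQ t := dot (f (gam t + t *: h) - f (gam t) - 'd f (gam t) (t *: h)) u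
  + dot (f (gam t + t *: h) - f (gam t)) h.
have Qd (t : R) : 0 <= t <= 1 -> is_derive t (1 : R) Q (dQ t).
  move=> t01; have Yg := Yseg w t Yw t01.
  have h1 := PF (w + h) Ywh t t01; have h2 := PF w Yw t t01.
  have h3 := is_derive_dot_line dot_norm h (df _ Yg).
  have h4 := is_deriveM (is_derive_id t (1 : R)) h3.
  have h5 := is_deriveB (is_deriveB h1 h2) h4.
  apply: (@is_derive_eq R R R Q t 1 _ _ h5).
  have lE : 'd f (gam t) (t *: h) = t *: 'd f (gam t) h by exact: linearZ_LR.
  have E : dot ('d f (gam t) (t *: h)) u = t * dot ('d f (gam t) u) h.
    by rewrite lE dotZl -(f_sym Yg h u) dotC.
  have wE : w + h - y0 = u + h by rewrite addrAC.
  rewrite /dQ /F wE scalerDr addrA.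
  exact: work_increment.
have [c c01 QE] := MVT01 Qd.
have -> : P (w + h) 1 - P (w + h) 0 - (P w 1 - P w 0) - dot (f w) h = dQ c.
  rewrite -QE /Q mul1r mul0r /gam scale1r [y0 + u]addrC subrK; ring.
have {}c01 : 0 <= c <= 1 by case/andP: c01 => *; rewrite !ltW.
have c1 : `|c *: h| <= `|h|.
  by case/andP: c01 => ? ?; rewrite normrZ ger0_norm// ler_piMl.
have {}lin := lin c c01 c c01; have {}incr := incr c c01 c c01.
rewrite /dQ (le_trans (ler_normD _ _))//.
have -> : e = e1 * `|u| + e1 by rewrite -[X in _ + X]mulr1 -mulrDr /e1 divfK// gt_eqF.
rewrite mulrDl lerD//.
  rewrite (le_trans (abs_dot_le dot_norm _ _))// mulrAC ler_wpM2r//.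
  by rewrite (le_trans lin)// ler_wpM2l// ltW.
rewrite (le_trans (abs_dot_le dot_norm _ _))// ler_wpM2r//.
Qed.

Hypothesis f_posdef : forall y, Y y -> positive_definite_op dot ('d f y).

(** Two mean values along v = y - z: psi y - psi z = <f (z + c v), v>, whose excess over <f z, v> is
    c <Df v, v> at an intermediate point, positive by positive definiteness. *)
Lemma strict_subgradient (psi : H -> R) :
  (forall w, Y w -> forall e : R, 0 < e ->
   \forall h \near 0, `|psi (w + h) - psi w - dot (f w) h| <= e * `|h|) ->
  forall y z, Y y -> Y z -> y != z -> psi z + dot (f z) (y - z) < psi y.
Proof.
move=> psid y z Yy Yz yz; pose v := y - z.
have v0 : v != 0 by rewrite subr_eq0.
have Yseg (t : R) : 0 <= t <= 1 -> Y (z + t *: v).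
  by apply: convex_set_segment => //; rewrite addrC subrK.
have dpsi (t : R) : 0 <= t <= 1 -> is_derive t (1 : R)
    (fun s => psi (z + s *: v) : R^o) (dot (f (z + t *: v)) v).
  move=> t01; have [|d dE] := @near_diff R H R^o psi (z + t *: v)
    (dot_right dot (f (z + t *: v))) _ (psid _ (Yseg t t01)).
    exact: dot_right_continuous.
  by have := is_derive_line d; rewrite dE.
have [c /andP[c0 c1] E] := MVT01 dpsi.
have [d /andP[d0 d1] E'] : exists2 d : R, 0 < d < 1 &
    dot (f (z + c *: v)) v - dot (f z) v = dot ('d f (z + d *: v) (c *: v)) v.
  have [|d /andP[d0 d1]] := @MVT01 R (fun s => dot (f (z + s *: (c *: v))) v)
      (fun t => dot ('d f (z + t *: (c *: v)) (c *: v)) v).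
    move=> t /andP[t0 t1]; apply: is_derive_dot_line => //; apply: f_C1.1.
    by rewrite scalerA; apply: Yseg; rewrite mulr_ge0 1?(ltW c0)//= mulr_ile1// ltW.
  rewrite scale1r scale0r addr0 => ->.
  exists (d * c); last by rewrite scalerA.
  by rewrite mulr_gt0//= mulr_ilt1// ltW.
have Yd : Y (z + d *: v) by apply: Yseg; rewrite !ltW.
rewrite scale1r scale0r addr0 [z + v]addrC subrK in E.
rewrite -(ltrBrDl) E -subr_gt0 E' linearZ dotZl mulr_gt0//.
by rewrite dotC f_posdef.
Qed.

End Potential.

(** * Local surjectivity of f under bounded invertibility *)

Section LocalInverse.
Context {R : realType} {H : completeNormedModType R}.

Lemma fixed_point_closed_ball (T : H -> H) (y : H) (r q : R) :
  0 < r -> 0 <= q < 1 ->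
  (forall u, `|y - u| <= r -> `|y - T u| <= r) ->
  (forall u v, `|y - u| <= r -> `|y - v| <= r ->
     `|T u - T v| <= q * `|u - v|) ->
  exists2 p, `|y - p| <= r & p = T p.
Proof.
move=> r0 /andP[q0 q1] Tball Tq.
pose U := closed_ball y r.
have UE u : U u <-> `|y - u| <= r by rewrite /U closed_ballE.
have TU : set_fun U U T by move=> u /UE/Tball/UE.
pose TF : {fun U >-> U} := HB.pack T (isFun.Build H H U U T TU).
have [||| p /UE ? ?] := @banach_fixed_point R H U TF; last by exists p.
- exists (NngNum q0); split=> //= -[u v] /= [/UE Uu /UE Uv].
  exact: Tq.
- exact: closed_ball_closed.
- by exists y; apply: closed_ballxx.
Qed.

Lemma open_mapping (dot : {dot H for idfun}) (dot_norm : norm_induced_by dot)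
    (Y : set H) (f : H -> H) (y : H) (A : set H) :
  open Y -> C1_on Y f -> Y y -> boundedly_invertible ('d f y) ->
  nbhs y A -> nbhs (f y) (f @` A).
Proof.
move=> oY fC1 Yy [M [LM ML [C MC]]] yA.
(* [M] is given as a mere function; additivity comes from the linear map it inverts. *)
have MB a b : M a - M b = M (a - b).
  by rewrite -[LHS]LM linearB !ML.
(* The maximum with 1 makes the bound positive, as [C] need not be. *)
pose D := Num.max C 1.
have D0 : 0 < D by rewrite lt_max ltr01 orbT.
have MD x : `|M x| <= D * `|x|.
  by rewrite (le_trans (MC x))// ler_wpM2r// le_max lexx.
(* Multiplied by the bound [D] on [M], this constant becomes the contraction factor 1/2 of the map
   [T] below. *)
have e0 : 0 < (2 * D)^-1 by rewrite invr_gt0 mulr_gt0.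
have [[A1 A2] /= [/nbhs_ballP[r1 /= r10 A1r] /nbhs_ballP[r2 /= r20 A2r]] sd] :=
  strict_diff dot_norm oY fC1 Yy e0.
have /nbhs_ballP[r3 /= r30 Ar] := yA.
pose m := Num.min r3 (Num.min r1 r2).
have m0 : 0 < m by rewrite !lt_min r10 r20 r30.
have /andP[m1 /andP[m2 m3]] : [&& m <= r1, m <= r2 & m <= r3].
  by rewrite /m !ge_min !lexx !orbT.
(* Points within [r] of [y] then differ by less than [r2] and stay within [r1] and [r3] of [y]. *)
pose r := m / 4.
have r0 : 0 < r by rewrite divr_gt0.
have rm : 4 * r = m by rewrite /r mulrC divfK// gt_eqF.
(* For such [x], [T y] is within r / 2 of [y]; contraction adds at most r / 2 more, so [T] maps the
   closed ball to itself. *)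
apply/nbhs_ballP; exists (r / (2 * D)); first by rewrite /= divr_gt0// mulr_gt0.
move=> x; rewrite -ball_normE /ball_ /= => xr.
(* Newton iteration with frozen derivative, for the equation f u = x. *)
pose T u := u - M (f u - x).
have Tq u v : `|y - u| <= r -> `|y - v| <= r -> `|T u - T v| <= 2^-1 * `|u - v|.
  move=> yu yv.
  have uv : `|u - v| < r2.
    by rewrite -(subrKA y) (le_lt_trans (ler_normD _ _))// (distrC u); lra.
  have : `|f (v + (u - v)) - f v - 'd f y (u - v)| <= (2 * D)^-1 * `|u - v|.
    apply: (sd (v, u - v)); split => /=.
      by apply: A1r; rewrite -ball_normE /ball_ /=; lra.
    by apply: A2r; rewrite -ball_normE /ball_ /= sub0r normrN.
  rewrite [v + _]addrC subrK.
  set w := (X in `|X| <= _) => wle.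
  have -> : T u - T v = M (- w).
    have fE : f u - f v = (f u - x) - (f v - x) by rewrite opprB subrKA.
    rewrite /w [in RHS]opprB -[RHS]MB LM [in RHS]fE -[in RHS]MB.
    by rewrite /T !opprD !opprK addrACA.
  rewrite (le_trans (MD _))// normrN.
  rewrite (le_trans (ler_wpM2l (ltW D0) wle))//.
  by rewrite invfM mulrA mulrCA mulfV ?gt_eqF// mulr1.
have yy : `|y - y| <= r by rewrite subrr normr0 ltW.
have [|||p yp pE] := @fixed_point_closed_ball T y r 2^-1 r0.
- lra.
- move=> u yu.
  rewrite -(subrKA (T y)) (le_trans (ler_normD _ _))//.
  have h1 := Tq y u yy yu.
  have h2 : `|y - T y| <= r / 2.
    rewrite /T opprB addrCA subrr addr0 (le_trans (MD _))//.
    by rewrite mulrC -ler_pdivlMr// (le_trans (ltW xr))// invfM mulrA.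
  lra.
- exact: Tq.
exists p; first by apply: Ar; rewrite -ball_normE /ball_ /=; lra.
have : M (f p - x) = 0.
  by apply/eqP; rewrite -oppr_eq0 -(inj_eq (addrI p)) addr0 -/(T p) -pE.
by move=> /(congr1 ('d f y)); rewrite ML linear0 => /subr0_eq.
Qed.

End LocalInverse.

(** * The function phi, its domain and its proximity operator *)

Section Penalty.
Context {R : realType} {H : completeNormedModType R} (dot : {dot H for idfun}).
Hypothesis dot_norm : norm_induced_by dot.
Variables (Y : set H) (f : H -> H) (psi : H -> R).
Hypothesis psi_sub : forall y z, Y y -> Y z -> y != z ->
  psi z + dot (f z) (y - z) < psi y.

(* [xget] returns the junk value 0 outside f @` Y. *)
Definition inverse_on (x : H) : H := xget 0 [set y | Y y /\ f y = x].

(** Under [psi_sub], on the image this is the Fenchel conjugate of psi, taken over [Y], minus half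
    the squared norm. *)
Definition penalty (x : H) : \bar R :=
  if x \in f @` Y then
    (dot (inverse_on x) x - 2^-1 * `|x| ^+ 2 - psi (inverse_on x))%:E
  else +oo%E.

Lemma subgradient y z : Y y -> Y z -> psi z + dot (f z) (y - z) <= psi y.
Proof.
move=> Yy Yz; have [->|yz] := eqVneq y z; last by rewrite ltW ?psi_sub.
by rewrite subrr dotC dot0l addr0.
Qed.

(** Adding the strict inequalities for (y, z) and (z, y) when f y = f z gives 0 < 0. *)
Lemma subgradient_inj : set_inj Y f.
Proof.
move=> y z /set_mem Yy /set_mem Yz fyz; apply/eqP/negPn/negP => yz.
have := psi_sub Yz Yy; rewrite eq_sym => /(_ yz).
have := psi_sub Yy Yz yz.
by rewrite fyz -[z - y]opprB dotNr; lra.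
Qed.

Lemma inverse_onK y : Y y -> inverse_on (f y) = y.
Proof.
move=> Yy; rewrite /inverse_on; case: xgetP => [z _ [Yz fz]|/(_ y)].
  exact: subgradient_inj (mem_set Yz) (mem_set Yy) fz.
by case.
Qed.

Lemma penalty_image y : Y y ->
  penalty (f y) = (dot y (f y) - 2^-1 * `|f y| ^+ 2 - psi y)%:E.
Proof.
by move=> Yy; rewrite /penalty mem_set ?inverse_onK//; exists y.
Qed.

Lemma edom_penalty : edom penalty = f @` Y.
Proof.
apply/seteqP; split=> [x|_ [y Yy <-]]; rewrite /edom /=.
  by rewrite /penalty; case: ifPn => [/set_mem//|]; rewrite ltxx.
by rewrite penalty_image// ltry.
Qed.

(** Once the squares cancel, minimising the objective over the image amounts to choosing the largest
    at [y] of the affine minorants of psi touching it at [z]. *)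
Lemma prox_objective_image y z : Y z ->
  prox_objective penalty y (f z) =
  (2^-1 * `|y| ^+ 2 - (psi z + dot (f z) (y - z)))%:E.
Proof.
move=> Yz; rewrite /prox_objective penalty_image// -EFinD; congr EFin.
rewrite !dot_norm !(dotE dot) (dotC dot z (f z)) (dotC dot (f z) y).
by move: (dot y y) (dot y (f z)) (dot (f z) (f z)) (dot (f z) z) => *; field.
Qed.

Lemma prox_penalty y : Y y -> prox penalty y = [set f y].
Proof.
move=> Yy.
have objE : prox_objective penalty y (f y) = (2^-1 * `|y| ^+ 2 - psi y)%:E.
  by rewrite prox_objective_image// subrr (dotC dot (f y)) dot0l addr0.
apply/seteqP; split=> [x [xfin xmin]|_ ->]; rewrite /prox /=; last first.
  rewrite objE ltry; split=> // z.
  have [[u Yu <-]|nz] := pselect ((f @` Y) z).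
    by rewrite prox_objective_image// lee_fin lerB// subgradient.
  by rewrite /prox_objective /penalty memNset// addey// leey.
have [[u Yu ux]|nx] := pselect ((f @` Y) x); last first.
  by move: xfin; rewrite /prox_objective /penalty memNset// addey// ltxx.
have := xmin (f y); rewrite -{1}ux objE prox_objective_image// lee_fin lerD2l lerN2 => h.
have [->|yu] := eqVneq y u; first by rewrite -ux.
by have := psi_sub Yy Yu yu; rewrite ltNge => /negP[]; lra.
Qed.

(** * Regularity of phi and critical points, when f is open *)

Hypothesis f_open : forall y A, Y y -> nbhs y A -> nbhs (f y) (f @` A).
Hypothesis Y_open : open Y.

Lemma inverse_on_continuous y : Y y -> {for f y, continuous inverse_on}.
Proof.
move=> Yy A; rewrite /= inverse_onK// => yA.
(* Intersecting with [Y] matters because [inverse_on] inverts [f] only there. *)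
have : nbhs (f y) (f @` (A `&` Y)).
  by apply: (f_open Yy); apply: filterI => //; exact: open_nbhs_nbhs.
by apply: filterS => _ [u [Au Yu] <-] /=; rewrite inverse_onK.
Qed.

Lemma image_nbhs y : Y y -> nbhs (f y) (f @` Y).
Proof. by move=> Yy; apply: (f_open Yy); exact: open_nbhs_nbhs. Qed.

(* The subgradient inequalities at y and at u squeeze the gap between 0 and
   <u - y, f u - f y>, and u - y -> 0 by continuity of the inverse. *)
Lemma near_subgradient_gap y : Y y -> forall e : R, 0 < e ->
  \forall h \near 0, exists2 u, Y u /\ f y + h = f u &
    `|dot (u - y) (f u) - (psi u - psi y)| <= e * `|h|.
Proof.
move=> Yy e e0.
have addh : f y + h @[h --> (0 : H)] --> f y.
  by rewrite -[X in _ --> X]addr0; apply: cvgD; [exact: cvg_cst|exact: cvg_id].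
have imN : \forall h \near (0 : H), (f @` Y) (f y + h).
  exact: addh (image_nbhs Yy).
have invN : \forall h \near (0 : H),
    `|inverse_on (f y) - inverse_on (f y + h)| < e.
  by have /cvgrPdist_lt/(_ e e0) := inverse_on_continuous Yy; exact: addh.
apply: filterS2 imN invN => h /= [u Yu uh] uy.
exists u => //; move: uy; rewrite -uh !inverse_onK// => uy.
have := subgradient Yu Yy; have := subgradient Yy Yu.
have -> : h = f u - f y by rewrite uh addrC addKr.
have := le_trans (ler_norm _) (abs_dot_le dot_norm (u - y) (f u - f y)).
have : `|u - y| * `|f u - f y| <= e * `|f u - f y|.
  by rewrite ler_wpM2r// distrC ltW.
rewrite -[y - u]opprB !(dotC dot (u - y)) !dotNr !dotDl dotNl => h1 h2 h3 h4.
rewrite ger0_norm; lra.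
Qed.

(** The first-order remainder between [f z] and [f u] is exactly the gap bounded in
    [near_subgradient_gap]. *)
Lemma prox_objective_gradient y z : Y z ->
  has_gradient dot (prox_objective penalty y) (f z) (z - y).
Proof.
move=> Yz.
have lc := @dot_right_continuous R H dot dot_norm (z - y).
have [|d dE] := @near_diff R H R^o (fine \o prox_objective penalty y) (f z) _ lc.
  move=> e e0; have := near_subgradient_gap Yz e0.
  apply: filterS => h [u [Yu uh]]; rewrite /= uh !prox_objective_image//=.
  have -> : h = f u - f z by rewrite -uh addrC addKr.
  apply: le_trans; rewrite le_eqVlt; apply/orP; left; apply/eqP; congr (`| _ |).
  rewrite /dot_right !(dotE dot).
  rewrite (dotC dot z (f u)) (dotC dot z (f z)) (dotC dot y (f u)) (dotC dot y (f z)) (dotC dot u (f u)).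
  ring.
split=> //; last by move=> h; rewrite dE.
by have := image_nbhs Yz; apply: filterS => _ [u Yu <-]; rewrite prox_objective_image.
Qed.

Lemma critical_points_penalty y : Y y -> critical_points dot penalty y = [set f y].
Proof.
move=> Yy; apply/seteqP; split=> [x []|_ ->]; last first.
  split; first by rewrite edom_penalty; exists y.
  by rewrite -(subrr y); exact: prox_objective_gradient.
rewrite edom_penalty => -[z Yz <-] [_ _ d0].
have [_ _ d] := prox_objective_gradient y Yz.
have := d0 (z - y); rewrite d dot0l -dot_norm => /eqP.
by rewrite sqrf_eq0 normr_eq0 subr_eq0 => /eqP ->.
Qed.

Lemma diff_penalty y : Y y ->
  differentiable (fine \o penalty : H -> R^o) (f y) /\
  'd (fine \o penalty : H -> R^o) (f y) = dot_right dot (y - f y) :> (H -> R^o).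
Proof.
move=> Yy; apply: near_diff; first exact: dot_right_continuous.
move=> e e0; have e20 : 0 < e / 2 by rewrite divr_gt0.
(* For |h| < e, the quadratic part |h|^2 / 2 of the remainder is at most (e / 2) |h|. *)
have hN : \forall h \near (0 : H), `|h| < e by exact: (@cvgr0_norm_lt _ _ _ _ _ id).
have := near_subgradient_gap Yy e20.
apply: filterS2 hN => h he [u [Yu uh]]; rewrite /= uh !penalty_image//= => gap.
set a := _ - dot_right _ _ _.
have -> : a = dot (u - y) (f u) - (psi u - psi y) - 2^-1 * `|h| ^+ 2.
  rewrite /a /dot_right.
  have -> : h = f u - f y by rewrite -uh addrC addKr.
  rewrite !dot_norm !(dotE dot) (dotC dot (f y) (f u)).
  by field.
rewrite (le_trans (ler_normB _ _))// [e in leRHS]splitr mulrDl lerD//.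
rewrite ger0_norm ?mulr_ge0// expr2 mulrA ler_wpM2r// mulrC.
by rewrite ler_wpM2r// ltW.
Qed.

(** The gradient at [x] is [inverse_on x - x], so continuity of the differential in operator norm
    follows from that of the inverse by Cauchy-Schwarz. *)
Lemma eC1_penalty : eC1_on (f @` Y) penalty.
Proof.
split=> [_ [y Yy <-]|].
  by have := image_nbhs Yy; apply: filterS => _ [u Yu <-]; rewrite penalty_image.
split=> [_ [y Yy <-]|_ [y Yy <-] e e0]; first by have [] := diff_penalty Yy.
have : {for f y, continuous (inverse_on \- id)}.
  by apply: cvgB; [exact: inverse_on_continuous|exact: cvg_id].
move=> /cvgrPdist_lt/(_ e e0); apply: filterS => x /= xy [u Yu ux] h.
move: xy; rewrite -ux !inverse_onK//= => uy.
have [_ ->] := diff_penalty Yy; have [_ ->] := diff_penalty Yu.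
rewrite /dot_right -dotNl -dotDl (le_trans (abs_dot_le dot_norm _ _))//.
by rewrite ler_wpM2r// distrC ltW.
Qed.

End Penalty.

Theorem corollary3 (R : realType) (H : completeNormedModType R)
    (dot : {dot H for idfun}) (dot_norm : norm_induced_by dot)
    (Y : set H) (Y_open : open Y)
    (Y_convex : convex_set (Y : set (convex_lmodType H)))
    (f : H -> H) (f_C1 : C1_on Y f)
    (f_sym : forall y, Y y -> symmetric_op dot ('d f y))
    (f_posdef : forall y, Y y -> positive_definite_op dot ('d f y)) :
  set_inj Y f /\
  exists phi : H -> \bar R,
    [/\ forall x, phi x != -oo%E,
        forall y, Y y -> prox phi y = [set f y],
        edom phi = f @` Y &
        (forall y, Y y -> boundedly_invertible ('d f y)) ->
          eC1_on (f @` Y) phi /\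
          forall y, Y y -> critical_points dot phi y = [set f y]].
Proof.
have [psi psi_diff] := potential dot_norm Y_open f_C1 Y_convex f_sym.
have psi_sub := strict_subgradient dot_norm f_C1 Y_convex f_posdef psi_diff.
split; first exact: subgradient_inj psi_sub.
exists (penalty dot Y f psi); split.
- by move=> x; rewrite /penalty; case: ifP.
- by move=> y; exact: prox_penalty.
- exact: edom_penalty.
move=> f_inv.
have f_open y A : Y y -> nbhs y A -> nbhs (f y) (f @` A).
  by move=> Yy; apply: open_mapping Yy (f_inv y Yy).
by split=> [|y Yy]; [exact: eC1_penalty|exact: critical_points_penalty].
Qed.
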